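(* Let $\tau$ be a regular infinite cardinal and let $G$ be a group such that $[G]^{\le \tau}$ contains a $\tau$-club consisting of supernormal subgroups of $G$. Then any set $A\subset G$ is $\tau$-algebraic in $G$ if and only if $A$ is unconditionally $\tau$-closed in $G$.
   Context: Let $G$ be a group with identity $1$ and $\tau$ a cardinal. A subset $A\subset G$ is elementary algebraic in $G$ if there is a word $w(x)$ in the alphabet $G\cup\{x^{\pm1}\}$ (i.e. an element $w(x)$ of the free product $G*\langle x\rangle$, $x$ a variable) such that $A=\{g\in G: w(g)=1\}$, where $w(g)$ is obtained by substituting $g$ for $x$. A subset of $G$ is $\tau$-additively algebraic if it can be represented as a union of fewer than $\tau$-many elementary algebraic sets. Arbitrary intersections of $\tau$-additively algebraic sets are called $\tau$-algebraic. A topology $\mathcal T$ is a $P_\tau$-topology if any intersection of fewer than $\tau$-many $\mathcal T$-open sets is $\mathcal T$-open. A subset $A$ of $G$ is unconditionally $\tau$-closed in $G$ if it is closed in every Hausdorff group $P_\tau$-topology on $G$ (a group topology is a topology making multiplication and inversion continuous). A subgroup $H$ of $G$ is supernormal in $G$ if for any $g\in G$ there exists an $h\in H$ such that $g^{-1}xg=h^{-1}xh$ for all $x\in H$. $[G]^{\le\tau}$ denotes the family of all subsets of $G$ of cardinality at most $\tau$, ordered by inclusion. A family $\mathcal C$ of subgroups of $G$ of cardinality $\le\tau$ is a $\tau$-club in $[G]^{\le\tau}$ if (i) every $X\in[G]^{\le\tau}$ is contained in a member of $\mathcal C$, and (ii) the union of any increasing chain of precisely $\tau$ members of $\mathcal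 C$ belongs to $\mathcal C$. *)

(* Defs.v *)
From HB Require Import structures.
From mathcomp Require Import all_boot.
From mathcomp Require Import all_classical wochoice topology.

Set Implicit Arguments.
Unset Strict Implicit.
Unset Printing Implicit Defensive.

Local Open Scope classical_set_scope.
Local Open Scope card_scope.
Local Open Scope group_scope.

(* A cardinal is an initial ordinal: a well-ordered type all of whose proper
   initial segments have smaller cardinality.  The order is kept because it
   indexes the chains in the definition of a club. *)

Definition card_lt (T U : Type) (A : set T) (B : set U) : Prop :=
  A #<= B /\ ~ (B #<= A).

Definition strict (T : Type) (le : rel T) : T -> T -> Prop :=
  fun a b => le a b /\ a <> b.

Record cardinal := Cardinal {
  card_sort :> Type;
  card_le_rel : rel card_sort;
  card_well_order : well_order card_le_rel;
  card_initial : forall b : card_sort,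
    card_lt [set a | strict card_le_rel a b] [set: card_sort] }.

Definition infinite_cardinal (tau : cardinal) : Prop := infinite_set [set: tau].

(* cf tau = tau *)
Definition regular_cardinal (tau : cardinal) : Prop :=
  forall S : set tau,
    (forall a, exists2 b, S b & card_le_rel a b) -> [set: tau] #<= S.

Definition fewer_than (tau : cardinal) (T : Type) (A : set T) : Prop :=
  card_lt A [set: tau].

Definition at_most (tau : cardinal) (T : Type) (A : set T) : Prop :=
  A #<= [set: tau].

(* A word in the alphabet G and x, x^-1 need not be reduced: every element of
   the free product of G and <x> is represented by such words, and all of its
   representatives take the same values under substitution. *)

Inductive letter (G : Type) := Coef of G | Var | VarInv.
Arguments Var {G}.
Arguments VarInv {G}.

Definition word (G : Type) := seq (letter G).

Definition eval_letter (G : groupType) (g : G) (l : letter G) : G :=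
  match l with Coef a => a | Var => g | VarInv => g^-1 end.

Definition eval_word (G : groupType) (w : word G) (g : G) : G :=
  \prod_(l <- w) eval_letter g l.

Definition elementary_algebraic (G : groupType) (A : set G) : Prop :=
  exists w : word G, A = [set g | eval_word w g = 1].

Definition additively_algebraic (tau : cardinal) (G : groupType) (A : set G) :
    Prop :=
  exists F : set (set G),
    [/\ F `<=` @elementary_algebraic G, fewer_than tau F
      & A = \bigcup_(B in F) B].

Definition algebraic (tau : cardinal) (G : groupType) (A : set G) : Prop :=
  exists2 F : set (set G),
    F `<=` @additively_algebraic tau G & A = \bigcap_(B in F) B.

(* The topologicalType structures on a given carrier *)

Definition topology_on (G : Type) := Topological.axioms_ G.

Definition space (G : Type) (t : topology_on G) : topologicalType :=
  Topological.Pack t.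

Definition group_topology (G : groupType) (t : topology_on G) : Prop :=
  continuous ((fun p : G * G => p.1 * p.2) : space t * space t -> space t) /\
  continuous ((fun x : G => x^-1) : space t -> space t).

Definition P_topology (tau : cardinal) (G : Type) (t : topology_on G) : Prop :=
  forall F : set (set (space t)),
    fewer_than tau F -> F `<=` open -> open (\bigcap_(U in F) U).

Definition unconditionally_closed (tau : cardinal) (G : groupType)
    (A : set G) : Prop :=
  forall t : topology_on G,
    group_topology t -> hausdorff_space (space t) -> P_topology tau t ->
    closed (A : set (space t)).

Definition subgroup (G : groupType) (H : set G) : Prop := group_closed [in H].

Definition supernormal (G : groupType) (H : set G) : Prop :=
  subgroup H /\
  forall g : G, exists2 h : G, H h &
    forall x, H x -> g^-1 * x * g = h^-1 * x * h.

Definition club (tau : cardinal) (G : groupType) (C : set (set G)) : Prop :=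
  [/\ forall H, C H -> subgroup H /\ at_most tau H,
      forall X : set G, at_most tau X -> exists2 H, C H & X `<=` H
    & forall H : tau -> set G,
        (forall a, C (H a)) ->
        (forall a b, strict (@card_le_rel tau) a b -> H a `<` H b) ->
        C (\bigcup_a H a)].

(* Main.v *)
Require Import Defs.
From HB Require Import structures.
From mathcomp Require Import all_boot.
From mathcomp Require Import all_classical wochoice topology.
From mathcomp Require Import zify.

(* Word maps are continuous, so algebraic sets are unconditionally closed.
   Conversely, let [p] lie outside [A] but in every additively algebraic set
   containing [A].  By transfinite recursion along [tau] one chooses [a d] in
   [p^-1 A] and an increasing club sequence of supernormal subgroups, with union
   [H] exhausted by small sets [K d], such that [a d] avoids every equation
   [w x = h] failing at [x = 1], where [h] is in [K d] and [w] ranges over a small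
   set of words built from [K d] and the earlier [a c].  The sets [V b],
   generated from the [a c]^(+-1) with [b <= c] by products and conjugations with
   strictly increasing subscripts, form a base at [1] of a group topology on [H]
   in which [a d] tends to [1].  Replacing in an element of [V b] the [a d] of
   largest subscript by [1] does not change its value when this value is in [K b],
   so [V b] meets [K b] only in [1] and the topology is Hausdorff.  As [H] is
   supernormal, the same base defines a group topology on [G], in which [p] lies in
   the closure of [A].  The subscripts make the argument work for [tau] = omega
   too, where words must have bounded length for there to be finitely many. *)

Set Implicit Arguments.
Unset Strict Implicit.
Unset Printing Implicit Defensive.

Local Open Scope classical_set_scope.
Local Open Scope card_scope.
Local Open Scope group_scope.

(** * Well-orders and small sets *)

Section WellOrder.
Context {T : Type} {R : rel T}.
Hypothesis Rwo : well_order R.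
Local Notation lt := (strict R).

Lemma wo_min (P : set T) : P !=set0 -> exists2 z, P z & forall x, P x -> R z x.
Proof.
move=> [x0 Px0]; have [|z [[Pz zmin] _]] := Rwo (A := [in P]).
  by exists x0; rewrite unfold_in /= in_setE.
exists z; first by move: Pz; rewrite unfold_in /= in_setE.
by move=> x Px; apply: zmin; rewrite unfold_in /= in_setE.
Qed.

Lemma wo_refl x : R x x.
Proof. by have [|z -> /(_ x erefl)] := @wo_min [set x]; first by exists x. Qed.

Lemma wo_total x y : R x y \/ R y x.
Proof.
have [|z [->|->] h] := @wo_min [set x; y]; first by exists x; left.
- by left; apply: h; right.
- by right; apply: h; left.
Qed.

Lemma wo_anti x y : R x y -> R y x -> x = y.
Proof.
move=> xy yx; have [|z [_ zu]] := Rwo (A := [in [set x; y]]).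
  by exists x; rewrite unfold_in /= in_setE; left.
rewrite -(zu x) ?(zu y) //; split; rewrite ?unfold_in /= ?in_setE.
- by right.
- by move=> u; rewrite unfold_in /= in_setE => -[->|->]//; apply: wo_refl.
- by left.
- by move=> u; rewrite unfold_in /= in_setE => -[->|->]//; apply: wo_refl.
Qed.

Lemma wo_trans x y z : R x y -> R y z -> R x z.
Proof.
move=> xy yz; have [|u [[|]|] -> h] := @wo_min [set x; y; z].
- by exists x; left; left.
- by apply: h; right.
- by rewrite -(wo_anti (h x (or_introl (or_introl erefl))) xy) in yz *.
- by rewrite (wo_anti (h y (or_introl (or_intror erefl))) yz).
Qed.

Lemma wo_nle x y : ~ R x y <-> lt y x.
Proof.
split=> [nxy|[yx ne] xy]; last exact/ne/wo_anti.
by split=> [|yx]; [have [] := wo_total x y|apply: nxy; rewrite yx wo_refl].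
Qed.

Lemma wo_lt_le_trans x y z : lt x y -> R y z -> lt x z.
Proof.
move=> [xy ne] yz; split=> [|xz]; first exact: wo_trans yz.
by apply: ne; apply: wo_anti => //; rewrite xz.
Qed.

Lemma wo_le_lt_trans x y z : R x y -> lt y z -> lt x z.
Proof.
move=> xy [yz ne]; split=> [|xz]; first exact: wo_trans yz.
by apply: ne; apply: wo_anti => //; rewrite -xz.
Qed.

Lemma wo_lt_trans x y z : lt x y -> lt y z -> lt x z.
Proof. by move=> xy [yz _]; apply: wo_lt_le_trans yz. Qed.

Lemma wo_trichotomy x y : [\/ lt x y, x = y | lt y x].
Proof.
have [->|ne] := pselect (x = y); first by constructor 2.
have [xy|yx] := wo_total x y; first by constructor 1.
by constructor 3; split=> // yx'; apply: ne.
Qed.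

Lemma wo_wf : well_founded lt.
Proof.
move=> x; apply: contrapT => nx.
have [z nz zmin] := @wo_min [set x | ~ Acc lt x] (ex_intro _ x nx).
apply: nz; constructor=> y yz; apply: contrapT => /zmin zy.
by case: (wo_nle z y) => _ /(_ yz).
Qed.

End WellOrder.

Lemma well_order_exists (T : Type) : exists R : rel T, well_order R.
Proof. by have [R Rwo] := @well_ordering_principle {classic T}; exists R. Qed.

(** Transfinite recursion with choices: [P t f] reads [f] only below [t], so a choice function
    applies to the part of [f] already built, completed by the junk value [x0]. *)
Lemma wf_choice (T X : Type) (lt : T -> T -> Prop) (x0 : X)
    (P : T -> (T -> X) -> X -> Prop) :
    well_founded lt ->
    (forall t f g x, (forall s, lt s t -> f s = g s) -> P t f x -> P t g x) ->
    (forall t f, exists x, P t f x) ->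
  exists f, forall t, P t f (f t).
Proof.
move=> wf Pext Pex.
have [c cP] : exists c : T -> (T -> X) -> X, forall t f, P t f (c t f).
  have [c cP] := choice (fun tf : T * (T -> X) => Pex tf.1 tf.2).
  by exists (fun t f => c (t, f)) => t f; apply: (cP (t, f)).
pose ext t (h : forall s, lt s t -> X) s :=
  if pselect (lt s t) is left st then h s st else x0.
pose f := Fix wf (fun=> X) (fun t h => c t (@ext t h)).
have fE t : f t = c t (@ext t (fun s _ => f s)).
  rewrite /f Fix_eq // => x h h' hh'; congr (c x _).
  by apply/funext => s; rewrite /ext; case: pselect.
exists f => t; rewrite fE; apply: Pext (cP t _) => s st.
by rewrite /ext; case: pselect.
Qed.

Lemma set_inj_card_le (T U : Type) (f : T -> U) (A : set T) :
  set_inj A f -> A #<= [set: U].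
Proof.
move=> /inj_card_eq/card_eqPle[_ Af].
exact: card_le_trans Af (card_leT _).
Qed.

(* Each point picks a value not taken on its initial segment. *)
Lemma segments_card_le (T U : Type) (R : rel T) : well_order R ->
    (forall x, ~ ([set: U] #<= [set y | strict R y x])) ->
  [set: T] #<= [set: U].
Proof.
move=> Rwo Rseg; have [[x0 _]|T0] := pselect (exists x : T, True); last first.
  rewrite (_ : [set: T] = set0); first exact: card_ge0.
  by apply/seteqP; split=> // x _; case: T0; exists x.
have [u0 _] : exists u : U, True.
  apply: contrapT => U0; apply: (Rseg x0).
  rewrite (_ : [set: U] = set0); first exact: card_ge0.
  by apply/seteqP; split=> // u _; case: U0; exists u.
pose P x (f : T -> U) u := forall y, strict R y x -> f y <> u.
have [||f fP] := @wf_choice T U _ u0 P (wo_wf Rwo).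
- by move=> x f g u fg fu y yx; rewrite -fg //; apply: fu.
- move=> x f; apply: contrapT => nP; apply: (Rseg x).
  apply: card_le_trans (card_image_le f _); apply: subset_card_le => u _.
  apply: contrapT => fu; apply: nP; exists u => y yx fyu.
  by apply: fu; exists y.
apply: (@set_inj_card_le _ _ f) => x y _ _ fxy.
by case: (wo_trichotomy Rwo x y) => // [/fP//|/fP]; rewrite fxy.
Qed.

(** Well-order [A]: either no initial segment is as large as [B], and [segments_card_le] applies, or
    one is, and so is [A]. *)
Lemma card_le_total (T U : Type) (A : set T) (B : set U) :
  A #<= B \/ B #<= A.
Proof.
have [R Rwo] := well_order_exists A.
have [h|] := pselect (forall x, ~ ([set: B] #<= [set y | strict R y x])).
  left; have := segments_card_le Rwo h.
  by rewrite (card_le_eql (card_setT _)) (card_le_eqr (card_setT _)).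
move=> /existsNP[x /contrapT h]; right.
have := card_le_trans h (card_leT _).
by rewrite (card_le_eql (card_setT _)) (card_le_eqr (card_setT _)).
Qed.

(** * Cardinal arithmetic at a regular cardinal *)

Section Small.
Context {tau : cardinal}.
Hypotheses (tau_infinite : infinite_cardinal tau) (tau_regular : regular_cardinal tau).
Local Notation le := (@card_le_rel tau).
Local Notation lt := (strict le).
Local Notation small := (@fewer_than tau _).
Let wo := @card_well_order tau.

Lemma smallP (T : Type) (A : set T) : small A <-> ~ ([set: tau] #<= A).
Proof.
by split=> [[]//|h]; split=> //; case: (card_le_total A [set: tau]).
Qed.

Lemma small_card_le (T U : Type) (A : set T) (B : set U) :
  A #<= B -> small B -> small A.
Proof. by move=> AB /smallP B_; apply/smallP => /card_le_trans/(_ AB). Qed.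

Lemma small_sub (T : Type) (A B : set T) : A `<=` B -> small B -> small A.
Proof. by move=> /subset_card_le; apply: small_card_le. Qed.

Lemma small_image (T U : Type) (f : T -> U) (A : set T) :
  small A -> small (f @` A).
Proof. exact/small_card_le/card_image_le. Qed.

Lemma small_finite (T : Type) (A : set T) : finite_set A -> small A.
Proof. by move=> fA; apply/smallP => /card_le_finite/(_ fA). Qed.

Lemma small_segment b : small [set a | lt a b].
Proof. exact: card_initial. Qed.

(** An unbounded set is cofinal, hence of size [tau] by regularity. *)
Lemma small_bounded (S : set tau) : small S -> exists b, forall a, S a -> lt a b.
Proof.
move=> /smallP Ssm; apply: contrapT => nb; apply/Ssm/tau_regular => b.
apply: contrapT => nS; apply: nb; exists b => a Sa.
by apply/(wo_nle wo) => ba; apply: nS; exists a.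
Qed.

Lemma lt_above a b : exists c, lt a c /\ lt b c.
Proof.
have [c h] := small_bounded (small_finite (finite_set2 a b)).
by exists c; split; apply: h; [left|right].
Qed.

Lemma small_segmentW b : small [set a | le a b].
Proof.
have [c [bc _]] := lt_above b b.
by apply: small_sub (small_segment c) => a ab; apply: (wo_le_lt_trans wo) bc.
Qed.

(** A map of the union onto [tau] would be bounded on each [F i], hence on the whole union, and
    would miss the common bound [c]. *)
Lemma small_bigcup (I T : Type) (J : set I) (F : I -> set T) :
  small J -> (forall i, J i -> small (F i)) -> small (\bigcup_(i in J) F i).
Proof.
move=> Jsm Fsm; apply/smallP => /pfcard_geP[t0|/surjfunPex[f fE]].
  by apply: tau_infinite; rewrite t0.
have /choice[b bP] : forall i, exists b, J i -> forall x, F i x -> lt (f x) b.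
  move=> i; have [Ji|nJ] := pselect (J i); last first.
    by have [b _] := infinite_setN0 tau_infinite; exists b.
  have [b bP] := small_bounded (small_image f (Fsm i Ji)).
  by exists b => _ x Fx; apply: bP; exists x.
have [c cP] := small_bounded (small_image b Jsm).
have : [set: tau] c by [].
rewrite fE => -[x [i Ji Fx] fx].
have xc := wo_lt_trans wo (bP i Ji x Fx) (cP _ (ex_intro2 _ _ i Ji erefl)).
by case: xc.
Qed.

Lemma small_image2 (T U V : Type) (f : T -> U -> V) (A : set T) (B : set U) :
  small A -> small B -> small [set f x y | x in A & y in B].
Proof.
move=> As Bs; have := small_bigcup As (fun x _ => small_image (f x) Bs).
by apply: small_sub => z [x Ax [y By <-]]; exists x => //; exists y.
Qed.

Lemma small_setU (T : Type) (A B : set T) :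
  small A -> small B -> small (A `|` B).
Proof.
move=> As Bs; apply: (@small_sub _ _ (\bigcup_b if b then A else B)).
  by move=> x [Ax|Bx]; [exists true|exists false].
by apply: small_bigcup => [|[]//]; apply: small_finite; apply: finite_finset.
Qed.

(** Sort by rank and break ties by any well-order: initial segments then lie in the small sets of
    bounded rank, and [segments_card_le] applies. *)
Lemma at_most_rank (T : Type) (r : T -> tau) :
  (forall b, small [set x | le (r x) b]) -> at_most tau [set: T].
Proof.
move=> rsm; have [R Rwo] := well_order_exists T.
pose S x y := `[< lt (r x) (r y) \/ r x = r y /\ R x y >].
have Swo : well_order S.
  apply: antisymmetric_well_order => [x y /andP[/asboolP xy /asboolP yx]|P [x0 Px0]].
    have ltN a b : lt a b -> lt b a -> False.
      by move=> ab ba; have [_] := wo_lt_trans wo ab ba.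
    case: xy yx => [xy|[rxy Rxy]] [yx|[ryx Ryx]].
    - by case: (ltN _ _ xy yx).
    - by case: xy => _; rewrite ryx.
    - by case: yx => _; rewrite rxy.
    - exact: wo_anti Rwo _ _ Rxy Ryx.
  have [_ [x1 Px1 <-] rmin] := @wo_min _ _ wo (r @` [set x | x \in P])
    (ex_intro _ _ (ex_intro2 _ _ x0 Px0 erefl)).
  have [x2 [Px2 rx2] Rmin] := @wo_min _ _ Rwo [set x | x \in P /\ r x = r x1]
    (ex_intro _ x1 (conj Px1 erefl)).
  exists x2; split=> // x Px; apply/asboolP; rewrite rx2.
  have [ne|] := pselect (r x1 = r x); last first.
    by left; split=> //; apply: rmin; exists x.
  by right; split=> //; apply: Rmin.
apply: (segments_card_le Swo) => x; apply/smallP.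
apply: small_sub (rsm (r x)) => y [/asboolP yx _] /=.
by case: yx => [[]|[-> _]] //; apply: wo_refl.
Qed.

(** Hessenberg's theorem; the rank of a pair is its maximum. *)
Lemma at_most_square : at_most tau [set: tau * tau].
Proof.
pose r (p : tau * tau) := if le p.1 p.2 then p.2 else p.1.
apply: (@at_most_rank _ r) => b.
apply: small_sub (small_image2 pair (small_segmentW b) (small_segmentW b)).
move=> [x y] /=; rewrite /r /=; case: ifPn => [xy yb|/negP/(wo_nle wo)[yx _] xb].
  by exists x; [apply: wo_trans xy yb|exists y].
by exists x => //; exists y => //; apply: (wo_trans wo) xb.
Qed.

Lemma at_most_surj (T : Type) (A : set T) : A !=set0 -> at_most tau A ->
  exists f : tau -> T, range f = A.
Proof.
move=> /set0P A0 /pfcard_geP[A00|/surjfunPex[f ->]]; last by exists f.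
by rewrite A00 eqxx in A0.
Qed.

Lemma at_most_bigcup (T : Type) (F : tau -> set T) :
  (forall i, at_most tau (F i)) -> at_most tau (\bigcup_i F i).
Proof.
move=> Fle; have [[t _]|U0] := pselect ((\bigcup_i F i) !=set0); last first.
  rewrite (_ : \bigcup_i F i = set0); first exact: card_ge0.
  by apply/seteqP; split=> // x Fx; apply: U0; exists x.
have /choice[f fF] : forall i, exists f : tau -> T, F i `<=` range f.
  move=> i; have [/at_most_surj/(_ (Fle i))[f <-]|F0] := pselect (F i !=set0).
    by exists f.
  by exists (fun=> t) => x Fx; case: F0; exists x.
apply: card_le_trans at_most_square.
apply: card_le_trans (card_image_le (fun p => f p.1 p.2) _).
by apply: subset_card_le => x [i _ /fF[j _ <-]]; exists (i, j).
Qed.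

Fixpoint words (T : Type) (S : set T) (n : nat) : set (seq T) :=
  if n is m.+1 then [set x :: w | x in S & w in words S m] else [set [::]].

Lemma words_cat (T : Type) (S : set T) m n u v :
  words S m u -> words S n v -> words S (m + n) (u ++ v).
Proof.
elim: m u => [|m IH] u /=; first by move=> ->.
by move=> [x Sx [w Sw <-]] Sv; exists x => //; exists (w ++ v) => //; apply: IH.
Qed.

Lemma small_words (T : Type) (S : set T) (N : set nat) :
  small S -> small N -> small (\bigcup_(n in N) words S n).
Proof.
move=> Ss Ns; apply: small_bigcup => // n _.
elim: n => [|n IH] /=; first exact/small_finite/finite_set1.
exact: small_image2.
Qed.

End Small.

(** * Neighbourhoods of the identity *)

Section EvalWord.
Context {G : groupType}.
Implicit Types (u v : word G) (g : G).

Lemma eval_word_nil g : eval_word [::] g = 1.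
Proof. exact: big_nil. Qed.

Lemma eval_word_cons l u g : eval_word (l :: u) g = eval_letter g l * eval_word u g.
Proof. exact: big_cons. Qed.

Lemma eval_word_cat u v g : eval_word (u ++ v) g = eval_word u g * eval_word v g.
Proof. exact: big_cat. Qed.

Definition eval_wordE := (eval_word_nil, eval_word_cons, eval_word_cat).

End EvalWord.

Section Neighbourhoods.
Context {tau : cardinal} {G : groupType}.
Hypotheses (tau_infinite : infinite_cardinal tau) (tau_regular : regular_cardinal tau).
Local Notation le := (@card_le_rel tau).
Local Notation lt := (strict le).
Local Notation small := (@fewer_than tau _).
Let wo := @card_well_order tau.

Section Definitions.
Variables (a : tau -> G) (K : tau -> set G).

(** [I] restricts the subscripts of the generators, so that the largest one can be split off. *)
Inductive basic_nbhd (I : set tau) : tau -> set G :=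
| basic_nbhd1 b : basic_nbhd I b 1
| basic_nbhd_gen b c : le b c -> I c -> basic_nbhd I b (a c)
| basic_nbhd_genV b c : le b c -> I c -> basic_nbhd I b (a c)^-1
| basic_nbhdM b b' x y : lt b b' -> basic_nbhd I b' x -> basic_nbhd I b' y ->
    basic_nbhd I b (x * y)
| basic_nbhdJ b b' g x : lt b b' -> K b' g -> basic_nbhd I b' x ->
    basic_nbhd I b (g^-1 * x * g).

(* The formal counterparts of the elements of [basic_nbhd [set c | le c d] b],
   with the variable in place of [a d]. *)
Inductive nbhd_word (d : tau) : tau -> set (word G) :=
| nbhd_word1 b : nbhd_word d b [::]
| nbhd_word_var b : le b d -> nbhd_word d b [:: Var]
| nbhd_word_varV b : le b d -> nbhd_word d b [:: VarInv]
| nbhd_word_gen b c : le b c -> lt c d -> nbhd_word d b [:: Coef (a c)]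
| nbhd_word_genV b c : le b c -> lt c d -> nbhd_word d b [:: Coef (a c)^-1]
| nbhd_wordM b b' u v : lt b b' -> nbhd_word d b' u -> nbhd_word d b' v ->
    nbhd_word d b (u ++ v)
| nbhd_wordJ b b' g u : lt b b' -> le b' d -> K b' g -> nbhd_word d b' u ->
    nbhd_word d b (Coef g^-1 :: u ++ [:: Coef g]).

End Definitions.

(** Locality: a word for [d] uses [a] only below [d] and, by the condition [le b' d] in
    [nbhd_wordJ], [K] only up to [d]. This permits choosing [a d] by recursion. *)
Lemma sub_nbhd_word a a' K K' d b w :
    (forall c, lt c d -> a c = a' c) -> (forall c, le c d -> K c `<=` K' c) ->
  nbhd_word a K d b w -> nbhd_word a' K' d b w.
Proof.
move=> aa' KK'; elim=> {b w}.
- by move=> b; apply: nbhd_word1.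
- by move=> b; apply: nbhd_word_var.
- by move=> b; apply: nbhd_word_varV.
- by move=> b c bc cd; rewrite aa' //; apply: nbhd_word_gen.
- by move=> b c bc cd; rewrite aa' //; apply: nbhd_word_genV.
- by move=> b b' u v bb' _ IHu _ IHv; apply: nbhd_wordM bb' _ _.
- by move=> b b' g u bb' b'd /(KK' _ b'd) Kg _; apply: nbhd_wordJ.
Qed.

Context {a : tau -> G} {K : tau -> set G}.
Local Notation V := (basic_nbhd a K).
Local Notation W := (nbhd_word a K).

Lemma basic_nbhd_sub I J b x : I `<=` J -> V I b x -> V J b x.
Proof.
move=> IJ; elim=> {b x}.
- exact: basic_nbhd1.
- by move=> b c bc /IJ; apply: basic_nbhd_gen.
- by move=> b c bc /IJ; apply: basic_nbhd_genV.
- by move=> b b' x y bb' _ + _; apply: basic_nbhdM.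
- by move=> b b' g x bb' Kg _; apply: basic_nbhdJ.
Qed.

Lemma basic_nbhd_le I b b' x : le b b' -> V I b' x -> V I b x.
Proof.
move=> bb' Vx; case: Vx bb' => {b' x}.
- by move=> *; apply: basic_nbhd1.
- by move=> b' c b'c Ic bb'; apply: basic_nbhd_gen => //; apply: (wo_trans wo) b'c.
- by move=> b' c b'c Ic bb'; apply: basic_nbhd_genV => //; apply: (wo_trans wo) b'c.
- move=> b' b'' x y b'b'' Vx Vy bb'; apply: basic_nbhdM Vx Vy.
  exact: (wo_le_lt_trans wo) b'b''.
- move=> b' b'' g x b'b'' Kg Vx bb'; apply: basic_nbhdJ Kg Vx.
  exact: (wo_le_lt_trans wo) b'b''.
Qed.

Lemma basic_nbhdV I b x : V I b x -> V I b x^-1.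
Proof.
elim=> {b x}.
- by move=> b; rewrite invg1; apply: basic_nbhd1.
- by move=> b c; apply: basic_nbhd_genV.
- by move=> b c; rewrite invgK; apply: basic_nbhd_gen.
- by move=> b b' x y bb' _ Vx _ Vy; rewrite invgM; apply: basic_nbhdM Vy Vx.
- move=> b b' g x bb' Kg _ Vx; rewrite !invgM invgK mulgA.
  exact: basic_nbhdJ Vx.
Qed.

Lemma basic_nbhd_set0 b x : V set0 b x -> x = 1.
Proof.
elim=> {b x} // [b b' x y _ _ -> _ ->|b b' g x _ _ _ ->]; first exact: mulg1.
by rewrite mulg1 mulVg.
Qed.

(** A derivation has finitely many generators, so one of largest subscript; [d0] serves when there
    are none. *)
Lemma basic_nbhd_top I d0 b x : I d0 -> V I b x ->
  exists2 d, I d & V [set c | le c d] b x.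
Proof.
move=> Id0; elim=> {b x}.
- by move=> b; exists d0 => //; apply: basic_nbhd1.
- by move=> b c bc Ic; exists c => //; apply: basic_nbhd_gen => //; apply: wo_refl.
- by move=> b c bc Ic; exists c => //; apply: basic_nbhd_genV => //; apply: wo_refl.
- move=> b b' x y bb' _ [d Id Vx] _ [d' Id' Vy].
  have [dd'|d'd] := wo_total wo d d'.
    exists d' => //; apply: basic_nbhdM bb' _ Vy; apply: basic_nbhd_sub Vx.
    by move=> c /= cd; apply: (wo_trans wo) dd'.
  exists d => //; apply: basic_nbhdM bb' Vx _; apply: basic_nbhd_sub Vy.
  by move=> c /= cd'; apply: (wo_trans wo) d'd.
- by move=> b b' g x bb' Kg _ [d Id Vx]; exists d => //; apply: basic_nbhdJ Kg Vx.
Qed.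

(** Beyond [d] every constructor that writes a letter is barred, which leaves products of empty
    words. *)
Lemma nbhd_word_nil d b w : lt d b -> W d b w -> w = [::].
Proof.
move=> db Ww; elim: Ww db => {b w} //.
- by move=> b bd /(wo_nle wo).
- by move=> b bd /(wo_nle wo).
- by move=> b c bc [cd _] /(wo_nle wo)[]; apply: (wo_trans wo) cd.
- by move=> b c bc [cd _] /(wo_nle wo)[]; apply: (wo_trans wo) cd.
- move=> b b' u v bb' _ IHu _ IHv db.
  by rewrite IHu ?IHv //; apply: wo_lt_trans bb'.
- by move=> b b' g u [bb' _] b'd _ _ _ /(wo_nle wo)[]; apply: (wo_trans wo) b'd.
Qed.

(** Each [a d] becomes the variable; evaluation at [1] then erases it and keeps only smaller
    subscripts. *)
Lemma nbhd_word_exists d b x : V [set c | le c d] b x ->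
  exists w, [/\ W d b w, eval_word w (a d) = x
              & V [set c | lt c d] b (eval_word w 1)].
Proof.
elim=> {b x}.
- by move=> b; exists [::]; rewrite !eval_wordE; split=> //; constructor.
- move=> b c bc /= cd; have [cE|ne] := pselect (c = d).
    rewrite cE; exists [:: Var]; rewrite !eval_wordE /= !mulg1.
    by split=> //; [apply: nbhd_word_var; rewrite -cE|apply: basic_nbhd1].
  exists [:: Coef (a c)]; rewrite !eval_wordE /= !mulg1.
  by split=> //; [apply: nbhd_word_gen|apply: basic_nbhd_gen].
- move=> b c bc /= cd; have [cE|ne] := pselect (c = d).
    rewrite cE; exists [:: VarInv]; rewrite !eval_wordE /= invg1 !mulg1.
    by split=> //; [apply: nbhd_word_varV; rewrite -cE|apply: basic_nbhd1].
  exists [:: Coef (a c)^-1]; rewrite !eval_wordE /= !mulg1.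
  by split=> //; [apply: nbhd_word_genV|apply: basic_nbhd_genV].
- move=> b b' x y bb' _ [u [Wu <- Vu]] _ [v [Wv <- Vv]].
  exists (u ++ v); rewrite !eval_wordE; split=> //.
    exact: nbhd_wordM Wu Wv.
  exact: basic_nbhdM Vu Vv.
- move=> b b' g x bb' Kg _ [u [Wu <- Vu]].
  (* If [lt d b'], words admit no conjugation by [g], but then [u] is empty and the conjugate is
     [1]. *)
  have [b'd|/(wo_nle wo) db'] := pselect (le b' d).
    exists (Coef g^-1 :: u ++ [:: Coef g]); rewrite !eval_wordE /= !mulg1 !mulgA.
    by split=> //; [apply: nbhd_wordJ Kg Wu|apply: basic_nbhdJ Kg Vu].
  rewrite (nbhd_word_nil db' Wu); exists [::].
  by rewrite !eval_wordE mulg1 mulVg; split=> //; [apply: nbhd_word1|apply: basic_nbhd1].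
Qed.

Hypothesis K_le : forall b c, le b c -> K b `<=` K c.

Definition nbhd_letters d : set (letter G) :=
  [set Var; VarInv] `|` @Coef G @` (a @` [set c | lt c d] `|` K d)
  `|` (fun g => Coef g^-1) @` (a @` [set c | lt c d] `|` K d).

Lemma small_nbhd_letters d : small (K d) -> small (nbhd_letters d).
Proof.
move=> Kd; have sm : small (a @` [set c | lt c d] `|` K d).
  by apply: small_setU => //; apply/small_image/small_segment.
apply: small_setU => //; last exact: small_image.
by apply: small_setU => //; [apply/small_finite/finite_set2|apply: small_image].
Qed.

Lemma nbhd_word_words d b w : W d b w -> words (nbhd_letters d) (size w) w.
Proof.
have words1 l : nbhd_letters d l -> words (nbhd_letters d) 1 [:: l].
  by move=> Sl; exists l => //; exists [::].
elim=> {b w} //.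
- by move=> b bd; apply: words1; left; left; left.
- by move=> b bd; apply: words1; left; left; right.
- by move=> b c bc cd; apply: words1; left; right; exists (a c) => //; left; exists c.
- by move=> b c bc cd; apply: words1; right; exists (a c) => //; left; exists c.
- by move=> b b' u v _ _ Su _ Sv; rewrite size_cat; apply: words_cat.
- move=> b b' g u _ b'd /(K_le b'd) Kg _ Su; rewrite -cat1s !size_cat.
  apply: words_cat; last apply: words_cat => //; apply: words1.
    by right; exists g => //; right.
  by left; right; exists g => //; right.
Qed.

(* The subscripts strictly increase along a derivation and, but for trivial
   words, do not exceed [d]: they bound its depth. *)
Lemma nbhd_word_size d : finite_set [set c | le c d] ->
  exists n, forall b w, W d b w -> (size w < n)%N.
Proof.
move=> /(@finite_seqP {classic tau})[s sE].
(* [k b] counts the subscripts from [b] to [d]; it drops at each step of a derivation that starts at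
   or below [d]. *)
pose k (b : {classic tau}) := count (fun c : {classic tau} => le b c) s.
have k_lt b b' : lt b b' -> le b d -> (k b' < k b)%N.
  move=> bb' bd; have bs : (b : {classic tau}) \in s.
    by move: bd; change ([set c | le c d] b -> (b : {classic tau}) \in s); rewrite sE.
  rewrite -addn1 /k.
  have b_count : (1 <= count (pred1 (b : {classic tau})) s)%N.
    by rewrite -has_count has_pred1.
  rewrite (leq_trans (leq_add (leqnn _) b_count)) //.
  rewrite -count_predUI (@eq_count _ (predI _ _) pred0) ?count_pred0 ?addn0; last first.
    move=> c /=; apply/negP => /andP[b'c /eqP cb].
    by move/(wo_nle wo): bb'; rewrite -cb.
  apply: sub_count => c /= /orP[b'c|/eqP->]; last exact: wo_refl.
  by have [bb'_ _] := bb'; apply: (wo_trans wo) b'c.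
have k_gt0 b : le b d -> (0 < k b)%N.
  move=> bd; rewrite /k -has_count; apply/hasP; exists b; last exact: wo_refl.
  by move: bd; change ([set c | le c d] b -> (b : {classic tau}) \in s); rewrite sE.
have exp_gt1 b : le b d -> (1 < 4 ^ k b)%N.
  move=> /k_gt0; case: (k b) => // n _.
  by rewrite expnS (leq_trans (_ : 1 < 4 * 1)%N) // leq_mul2l expn_gt0.
(* Base 4 leaves room for the doubling in a product and for the two letters added by a
   conjugation. *)
exists (4 ^ size s)%N => b w Ww.
suff: (size w < 4 ^ k b)%N.
  by move=> /leq_trans; apply; rewrite leq_exp2l // count_size.
elim: Ww => {b w} /=.
- by move=> b; rewrite expn_gt0.
- by move=> b /exp_gt1.
- by move=> b /exp_gt1.
- by move=> b c bc [cd _]; apply: exp_gt1; apply: (wo_trans wo) cd.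
- by move=> b c bc [cd _]; apply: exp_gt1; apply: (wo_trans wo) cd.
- move=> b b' u v bb' Wu IHu Wv IHv; rewrite size_cat.
  have [bd|/(wo_nle wo) db] := pselect (le b d); last first.
    have db' := wo_lt_trans wo db bb'.
    by rewrite (nbhd_word_nil db' Wu) (nbhd_word_nil db' Wv) expn_gt0.
  have := leq_exp2l (k b').+1 (k b) (isT : 1 < 4)%N; rewrite (k_lt _ _ bb' bd) expnS.
  by move: IHu IHv; lia.
- move=> b b' g u bb' b'd _ _ IHu; rewrite size_cat /=.
  have bd : le b d by apply: (wo_trans wo) b'd; case: bb'.
  have := leq_exp2l (k b').+1 (k b) (isT : 1 < 4)%N; rewrite (k_lt _ _ bb' bd) expnS.
  by move: IHu (exp_gt1 b' b'd); lia.
Qed.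

(** The alphabet is small, so only lengths matter. They are bounded if [d] has finitely many
    predecessors; otherwise the set of all lengths embeds in a small segment and is itself small. *)
Lemma small_nbhd_word d : small (K d) -> small (\bigcup_b W d b).
Proof.
move=> Kd; have [N [Nsm NP]] :
    exists N : set nat, small N /\ forall b w, W d b w -> N (size w).
  have [/nbhd_word_size[n nP]|/infiniteP inf] := pselect (finite_set [set c | le c d]).
    by exists `I_n; split; [apply/small_finite/finite_II|apply: nP].
  exists setT; split=> //.
  exact: small_card_le inf (small_segmentW tau_infinite tau_regular d).
apply: small_sub (small_words tau_infinite tau_regular (small_nbhd_letters Kd) Nsm).
by move=> w [b _ Ww]; exists (size w); [apply: NP Ww|apply: nbhd_word_words Ww].
Qed.

Hypothesis a_generic : forall d b w h, W d b w -> K d h ->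
  eval_word w 1 <> h -> eval_word w (a d) <> h.

(** Induction on the largest subscript [d] occurring in [x]. *)
Lemma basic_nbhd_trivial b x : V setT b x -> K b x -> x = 1.
Proof.
suff top d : V [set c | le c d] b x -> K b x -> x = 1.
  by move=> Vx; have [d _ /top] := basic_nbhd_top (I := setT) (d0 := b) Logic.I Vx.
elim/(well_founded_ind (wo_wf wo)): d => d IH Vx Kx.
have [w [Ww wa V1]] := nbhd_word_exists Vx.
have [bd|/(wo_nle wo) db] := pselect (le b d); last first.
  by rewrite -wa (nbhd_word_nil db Ww) eval_wordE.
(* Genericity read backwards: [w] takes at [a d] the value [x], which is in [K d], so it takes the
   same value at [1], and [x] needs only subscripts below [d]. *)
move: V1; have -> : eval_word w 1 = x.
  by apply: contrapT => /(a_generic Ww (K_le bd Kx)); rewrite wa.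
(* If [d] is the least subscript, no generators remain. *)
have [[d0 d0d]|nd] := pselect (exists d0, lt d0 d).
  move=> Vlt; have [d' d'd Vx'] := basic_nbhd_top (I := [set c | lt c d]) d0d Vlt.
  exact: IH d'd Vx' Kx.
rewrite (_ : [set c | lt c d] = set0); first exact: basic_nbhd_set0.
by apply/seteqP; split=> // c cd; case: nd; exists c.
Qed.

End Neighbourhoods.

(** * The topology *)

Lemma topology_of_nbhs (T : choiceType) (N : T -> set_system T) :
    (forall p, ProperFilter (N p)) -> (forall p A, N p A -> A p) ->
    (forall p A, N p A -> N p (N^~ A)) ->
  exists t : topology_on T, forall p : space t, nbhs p = N p.
Proof.
move=> Nfilter Nself Nnbhs.
pose nT : nbhsType := HB.pack_for nbhsType T (hasNbhs.Build T N).
pose tT : topologicalType := HB.pack_for topologicalType nT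
  (Nbhs_isNbhsTopological.Build nT Nfilter Nself Nnbhs).
by exists (Topological.class tT).
Qed.

Section GroupTopology.
Context {tau : cardinal} {G : groupType} {V : tau -> set G}.
Hypotheses (tau_infinite : infinite_cardinal tau) (tau_regular : regular_cardinal tau).
Local Notation le := (@card_le_rel tau).
Hypotheses (V1 : forall b, V b 1) (V_le : forall b c, le b c -> V c `<=` V b)
  (VM : forall b, exists c, forall x y, V c x -> V c y -> V b (x * y))
  (VV : forall b x, V b x -> V b x^-1)
  (VJ : forall g b, exists c, forall x, V c x -> V b (g^-1 * x * g))
  (V_sep : forall g, (forall b, V b g) -> g = 1).

(** The translates [p V b] are taken as a base at [p]. *)
Lemma group_topology_of_base : exists t : topology_on G,
  [/\ group_topology t, hausdorff_space (space t), P_topology tau t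
    & forall (p : G) (A : set G),
        nbhs (p : space t) A <-> exists b, forall x, V b x -> A (p * x)].
Proof.
have [b0 _] := infinite_setN0 tau_infinite.
have common b c : exists d, V d `<=` V b /\ V d `<=` V c.
  have [d [[bd _] [cd _]]] := lt_above tau_infinite tau_regular b c.
  by exists d; split; apply: V_le.
pose N (p : G) : set_system G := [set A | exists b, forall x, V b x -> A (p * x)].
have [||| t tE] := @topology_of_nbhs G N.
- move=> p; apply: Build_ProperFilter_ex.
    by move=> A [b bA]; exists (p * 1); apply/bA/V1.
  split=> [|A B [b bA] [c cB]|A B AB [b bA]].
  + by exists b0.
  + have [d [db dc]] := common b c.
    by exists d => x Vx; split; [apply/bA/db|apply/cB/dc].
  + by exists b => x /bA/AB.
- by move=> p A [b bA]; rewrite -[p]mulg1; apply/bA/V1.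
- move=> p A [b bA]; have [c cb] := VM b; exists c => x Vx; exists c => y Vy.
  by rewrite -mulgA; apply/bA/cb.
exists t.
have nbhsP (p : G) (A : set G) :
    nbhs (p : space t) A <-> exists b, forall x, V b x -> A (p * x).
  by rewrite tE.
split=> //.
- split=> [[x y] A /nbhsP[b bA]|x A /nbhsP[b bA]].
    (* [(x u)(y v) = x y (y^-1 u y) v]. *)
    have [c cb] := VM b; have [d dc] := VJ y c.
    exists ([set z | V d (x^-1 * z)], [set z | V c (y^-1 * z)]).
      by split; apply/nbhsP; [exists d|exists c] => z /=; rewrite mulKg.
    move=> [z1 z2] /= [Vz1 Vz2].
    have := bA _ (cb _ _ (dc _ Vz1) Vz2).
    by rewrite /= !mulgA !mulgK (mulgV (x : G)) mul1g.
  (* [(x v)^-1 = x^-1 (x v^-1 x^-1)]. *)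
  have [d db] := VJ x^-1 b; apply/nbhsP; exists d => v /VV/db/bA.
  by rewrite /= invgK invgM !mulgA mulVg mul1g.
- move=> p q pq; apply/esym.
  suff pq1 : p^-1 * q = 1 by rewrite -(mulVKg p q) pq1 mulg1.
  apply: V_sep => b; have [c cb] := VM b.
  (* If [p V c] and [q V c] meet, then [p x = q y] gives [p^-1 q = x y^-1], which lies in [V b]. *)
  have [|| z [[x Vx xz] [y Vy yz]]] := pq [set p * x | x in V c] [set q * x | x in V c].
  + by apply/nbhsP; exists c => x Vx; exists x.
  + by apply/nbhsP; exists c => x Vx; exists x.
  + have -> : p^-1 * q = x * y^-1.
      by apply: (mulIg y); rewrite mulgVK -mulgA yz -xz mulKg.
    by apply: cb => //; apply: VV.
- move=> F Fsm Fopen; rewrite openE => p Fp.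
  have /choice[f fP] : forall U : set (space t), exists b,
      F U -> forall x, V b x -> U ((p : G) * x).
    move=> U; have [FU|nFU] := pselect (F U); last by exists b0.
    have := Fopen _ FU; rewrite openE => /(_ p (Fp _ FU))/nbhsP[b bU].
    by exists b.
  (* By regularity one subscript [b] serves all members of [F] at once. *)
  have [b bP] := small_bounded tau_regular (small_image f Fsm).
  apply/nbhsP; exists b => x Vx U FU; apply: fP => //.
  by apply: V_le Vx; case: (bP _ (ex_intro2 _ _ U FU erefl)).
Qed.

End GroupTopology.

(** * Closed sets and the generic sequence *)

Lemma eval_word_continuous (G : groupType) (t : topology_on G) (w : word G) :
  group_topology t -> continuous (eval_word w : space t -> space t).
Proof.
move=> [mulC invC]; elim: w => [|l w IH].
  rewrite (_ : eval_word _ = fun=> 1); first by move=> x; apply: cvg_cst.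
  by apply/funext => x; rewrite eval_word_nil.
rewrite (_ : eval_word _ = fun x => eval_letter x l * eval_word w x); last first.
  by apply/funext => x; rewrite eval_word_cons.
move=> x; apply: (@continuous2_cvg _ (space t) (space t) (space t) _ _
  (fun x => eval_letter x l) (eval_word w) (fun x y : G => x * y)
  (eval_letter x l) (eval_word w x)).
- exact: (@nbhs_filter (space t) x).
- exact: (mulC (eval_letter x l, eval_word w x)).
- case: l => [a||] /=; last exact: invC.
    exact: (@cst_continuous (space t) (space t) a x).
  exact: cvg_id.
- exact: IH.
Qed.

(** Elementary algebraic sets are preimages of the closed point [1] under word maps. The complement
    of a small union of them is a small intersection of open sets, hence open. *)
Lemma algebraic_unconditionally_closed (tau : cardinal) (G : groupType) (A : set G) :
  algebraic tau A -> unconditionally_closed tau A.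
Proof.
move=> [F Falg ->] t tG tH tP.
apply: (@closed_bigI (space t)) => B /Falg [E [Eelem Esm ->]].
rewrite -[X in closed X]setCK closedC setC_bigcup.
rewrite (_ : \bigcap_(C in E) ~` C = \bigcap_(U in [set ~` C | C in E]) U); last first.
  by rewrite bigcap_image.
apply: tP; first exact: small_image.
move=> _ [C /Eelem[w ->] <-]; rewrite openC.
apply: (closed_comp (f := eval_word w : space t -> space t) (D := [set 1])).
  by move=> x _; apply: eval_word_continuous.
exact/accessible_closed_set1/hausdorff_accessible.
Qed.

Section Translation.
Context {G : groupType}.

(** Substitution of [p^-1 x] for [x], which moves equations from [1] to [p]. *)
Definition translate_letter (p : G) (l : letter G) : word G :=
  match l with
  | Coef a => [:: Coef a]
  | Var => [:: Coef p^-1; Var]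
  | VarInv => [:: VarInv; Coef p]
  end.

Definition translate_word (p : G) (w : word G) : word G :=
  flatten (map (translate_letter p) w).

Lemma eval_translate_word p w g :
  eval_word (translate_word p w) g = eval_word w (p^-1 * g).
Proof.
elim: w => [|l w IH]; first by rewrite !eval_wordE.
rewrite /translate_word /= -/(translate_word p w) eval_word_cat IH.
rewrite eval_word_cons; congr (_ * _).
by case: l => [a||]; rewrite /= !eval_wordE /= ?mulg1 // invgM invgK.
Qed.

End Translation.

(** If each point of [p^-1 A] solved some equation of [S], the translated solution sets would form
    an additively algebraic set that contains [A] but not [p]. *)
Lemma avoid_words (tau : cardinal) (G : groupType) (A : set G) (p : G)
    (S : set (word G)) :
    (forall B, additively_algebraic tau B -> A `<=` B -> B p) ->
    fewer_than tau S -> (forall w, S w -> eval_word w 1 <> 1) ->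
  exists2 x, A (p * x) & forall w, S w -> eval_word w x <> 1.
Proof.
move=> pA Ssm S1; apply: contrapT => nx.
pose Z w := [set g | eval_word (translate_word p w) g = 1].
have [] : (\bigcup_(B in Z @` S) B) p; last first.
  by move=> _ [w Sw <-]; rewrite /Z /= eval_translate_word mulVg; apply: S1.
apply: pA.
  exists (Z @` S); split=> //; last exact: small_image.
  by move=> _ [w _ <-]; exists (translate_word p w).
move=> g Ag; apply: contrapT => ng; apply: nx; exists (p^-1 * g).
  by rewrite mulVKg.
move=> w Sw; rewrite -eval_translate_word => wg1; apply: ng.
by exists (Z w) => //; exists w.
Qed.

(** * Transfinite construction of the generic sequence *)

Section GenericSequence.
Context {tau : cardinal} {G : groupType}.
Hypotheses (tau_infinite : infinite_cardinal tau) (tau_regular : regular_cardinal tau).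
Local Notation le := (@card_le_rel tau).
Local Notation lt := (strict le).
Local Notation small := (@fewer_than tau _).
Let wo := @card_well_order tau.

Context {C : set (set G)} (C_club : club tau C).
Hypothesis C_supernormal : forall H, C H -> supernormal H.

Lemma generic_sequence (B : set G) :
    (forall S : set (word G), small S -> (forall w, S w -> eval_word w 1 <> 1) ->
       exists2 x, B x & forall w, S w -> eval_word w x <> 1) ->
  exists (H : set G) (a : tau -> G) (K : tau -> set G),
    [/\ supernormal H,
        forall b c, le b c -> K b `<=` K c,
        H = \bigcup_d K d,
        forall d, H (a d) /\ B (a d)
      & forall d b w h, nbhd_word a K d b w -> K d h ->
          eval_word w 1 <> h -> eval_word w (a d) <> h].
Proof.
move=> Bavoid; have [C_sub C_cof C_chain] := C_club.
have C_ne H : C H -> H !=set0.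
  by move=> /C_sub[[+ _] _]; rewrite in_setE => H1; exists 1.
(* The recursion chooses [a d] together with a club member [H d]. *)
pose X := (G * {H : set G | C H})%type.
have [H0 CH0 _] : exists2 H, C H & set0 `<=` H by apply: C_cof; apply: card_ge0.
have /choice[e eP] : forall H : {H : set G | C H},
    exists e : tau -> G, range e = sval H.
  move=> [H CH] /=; apply: at_most_surj; first exact: C_ne.
  by have [] := C_sub _ CH.
(* This becomes [K d]: bounding both the stage [c] and the position [i] in the enumeration of [H c]
   by [d] keeps it small. *)
pose enum (f : tau -> X) d : set G :=
  [set e (f c).2 i | c in [set c | lt c d] & i in [set i | lt i d]].
pose below (f : tau -> X) d : set G := \bigcup_(c in [set c | lt c d]) sval (f c).2.
(* The last clause forces strict growth, which the chain condition of a club demands, unless the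
   earlier members already cover [G]. *)
pose P d (f : tau -> X) (x : X) := [/\ B x.1,
   forall b w h, nbhd_word (fst \o f) (enum f) d b w -> enum f d h ->
     eval_word w 1 <> h -> eval_word w x.1 <> h,
   below f d `<=` sval x.2, sval x.2 x.1
 & below f d = setT \/ exists2 y, sval x.2 y & ~ below f d y].
have enum_small f d : small (enum f d).
  by apply: small_image2 => //; apply: small_segment.
have enum_le f b c : le b c -> enum f b `<=` enum f c.
  move=> bc _ [i ib [j jb <-]]; exists i; first exact: (wo_lt_le_trans wo) bc.
  by exists j => //; apply: (wo_lt_le_trans wo) bc.
have [f fP] : exists f, forall d, P d f (f d).
  apply: (@wf_choice _ X lt (1, exist _ H0 CH0) P (wo_wf wo)).
    move=> d f g x fg [xB xW xbelow xH xnew].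
    have fg' : forall c b, lt c b -> le b d -> f c = g c.
      by move=> c b cb bd; apply/fg/(wo_lt_le_trans wo cb bd).
    have enumE b : le b d -> enum f b = enum g b.
      by move=> bd; apply/seteqP; split=> _ [c cb [i ib <-]];
        exists c => //; exists i => //; rewrite (fg' c b).
    have belowE : below f d = below g d.
      by apply/eq_bigcupr => c cd; rewrite fg.
    split=> //; rewrite -?belowE //.
    move=> b w h Ww; rewrite -enumE; last exact: wo_refl.
    apply: xW; apply: sub_nbhd_word Ww.
      by move=> c cd; rewrite /= fg.
    by move=> c cd; rewrite enumE.
  move=> d f.
  (* The equation [w x = h] is written [h^-1 w x = 1]; only those failing at [x = 1] are kept. *)
  pose S : set (word G) := [set w | (exists2 h, enum f d h & exists2 u,
    (\bigcup_b nbhd_word (fst \o f) (enum f) d b) u & w = Coef h^-1 :: u)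
    /\ eval_word w 1 <> 1].
  have [||x Bx xS] := Bavoid S.
  - apply: (@small_sub tau _ _ [set Coef h^-1 :: u | h in enum f d &
      u in \bigcup_b nbhd_word (fst \o f) (enum f) d b]).
      by move=> _ [[h Kh [u Wu ->]] _]; exists h => //; exists u.
    apply: small_image2 => //; apply: small_nbhd_word => //.
    by move=> b c; apply: enum_le.
  - by move=> w [].
  have [y yP] : exists y, below f d = setT \/ ~ below f d y.
    have [?|/existsNP[y ny]] := pselect (forall y, below f d y).
      by exists 1; left; apply/seteqP; split.
    by exists y; right.
  have [|H CH HP] := C_cof
      (* Indices not below [d], such as [d] itself, bring in the new points [x] and [y]. *)
      (\bigcup_c if pselect (lt c d) then sval (f c).2 else [set x; y]).
    apply: at_most_bigcup => // c; case: pselect => ?.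
      by case: (f c).2 => H CH /=; have [] := C_sub _ CH.
    by have [] := small_finite tau_infinite (finite_set2 x y).
  have xyH : [set x; y] `<=` H.
    move=> z xyz; apply: HP; exists d => //; case: pselect => // dd.
    by case: dd.
  exists (x, exist _ H CH); split=> //=.
  - move=> b w h Ww Kh ne; have : ~ S (Coef h^-1 :: w) \/ S (Coef h^-1 :: w).
      by rewrite orC; apply: EM.
    have hE g : eval_word (Coef h^-1 :: w) g = 1 <-> eval_word w g = h.
      rewrite eval_word_cons /=; split=> [E|->]; last exact: mulVg.
      by rewrite -(mulVKg h (eval_word w g)) E mulg1.
    case=> [nS|/xS nx /hE//]; case: nS; split; last by move=> /hE.
    by exists h => //; exists w => //; exists b.
  - move=> z [c cd fz]; apply: HP; exists c => //.
    by case: pselect.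
  - by apply: xyH; left.
  - by case: yP => [?|ny]; [left|right; exists y => //; apply: xyH; right].
pose H c := sval (f c).2.
have CH c : C (H c) by rewrite /H; case: (f c).2.
exists (\bigcup_c H c), (fst \o f), (enum f); split.
(* If some stage already covers [G], the union is [G], where [h = g] witnesses supernormality;
   otherwise the chain is strictly increasing and the club contains its union. *)
- have [[d dT]|nT] := pselect (exists d, below f d = setT).
    rewrite (_ : \bigcup_c H c = setT); last first.
      apply/seteqP; split=> // x _; have : below f d x by rewrite dT.
      by move=> [c _ Hx]; exists c.
    split; first by split=> [|x y _ _]; rewrite in_setE.
    by move=> g; exists g.
  apply/C_supernormal/C_chain => // b c bc.
  have [_ _ sub _ [cT|[y Hy ny]]] := fP c; first by case: nT; exists c.
  split; first by move=> x Hx; apply: sub; exists b.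
  by move=> /(_ y Hy) Hby; apply: ny; exists b.
- by move=> b c; apply: enum_le.
- apply/seteqP; split=> [x [c _ Hx]|x [d _ [c _ [i _ <-]]]].
    move: Hx; rewrite /H -eP => -[i _ <-].
    have [d [cd id]] := lt_above tau_infinite tau_regular c i.
    by exists d => //; exists c => //; exists i.
  by exists c => //; rewrite /H -eP; exists i.
- by move=> d; have [Bd _ _ Hd _] := fP d; split=> //; exists d.
- by move=> d b w h Ww; have [_ dW _ _ _] := fP d; apply: dW Ww.
Qed.

End GenericSequence.

(** * The equivalence *)

Theorem corollary1 (tau : cardinal) (tau_infinite : infinite_cardinal tau)
    (tau_regular : regular_cardinal tau) (G : groupType)
    (G_club : exists C : set (set G),
       club tau C /\ (forall H : set G, C H -> supernormal H))
    (A : set G) :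
  algebraic tau A <-> unconditionally_closed tau A.
Proof.
split; first exact: algebraic_unconditionally_closed.
move=> Aclosed; have [C [C_club C_supernormal]] := G_club.
(* The largest possible family: its intersection has to be shown to lie in [A]. *)
exists [set B | additively_algebraic tau B /\ A `<=` B]; first by move=> B [].
apply/seteqP; split=> [x Ax B [_]|p pA]; first exact.
apply: contrapT => nAp.
have [|H [a [K [[[H1 Hdiv] Hinner] K_le HE aHB a_gen]]]] :=
    generic_sequence tau_infinite tau_regular C_club C_supernormal
      (B := [set x | A (p * x)]).
  by move=> S; apply: avoid_words => B; move=> Balg AB; apply: pA.
have HV x : H x -> H x^-1.
  move=> Hx; rewrite -[x^-1]mul1g -in_setE; apply: (Hdiv 1 x) => //.
  by rewrite in_setE.
have HM x y : H x -> H y -> H (x * y).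
  move=> Hx Hy; rewrite -[y]invgK -in_setE; apply: (Hdiv x y^-1); rewrite in_setE //.
  exact: HV.
pose V := basic_nbhd a K setT.
have HK b x : K b x -> H x by move=> Kx; rewrite HE; exists b.
have VH b x : V b x -> H x.
  elim=> {b x} [b|b c _ _|b c _ _|b b' x y _ _ Hx _ Hy|b b' g x _ Kg _ Hx].
  - by rewrite -in_setE.
  - by have [] := aHB c.
  - by apply: HV; have [] := aHB c.
  - exact: HM.
  - by apply/(HM _ _ _ (HK _ _ Kg))/HM => //; apply/HV/(HK _ _ Kg).
(* An element of every [V b] lies in [H], hence in some [K b], which meets [V b] only in [1]. *)
have V_sep g : (forall b, V b g) -> g = 1.
  move=> Vg; have [b0 _] := infinite_setN0 tau_infinite.
  have := VH b0 g (Vg b0); rewrite HE => -[b _ Kg].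
  exact: (basic_nbhd_trivial K_le a_gen (Vg b) Kg).
have VM b : exists c, forall x y, V c x -> V c y -> V b (x * y).
  have [c [bc _]] := lt_above tau_infinite tau_regular b b.
  by exists c => x y; apply: basic_nbhdM.
(* On [H], which contains every [V c], conjugation by [g] is conjugation by some
   [h] in [H]. *)
have VJ g b : exists c, forall x, V c x -> V b (g^-1 * x * g).
  have [h Hh gh] := Hinner g; move: Hh; rewrite HE => -[d _ Kh].
  have [c [bc [dc _]]] := lt_above tau_infinite tau_regular b d.
  exists c => x Vx; rewrite gh; last exact: VH Vx.
  exact: basic_nbhdJ bc (K_le _ _ dc _ Kh) Vx.
have V1 b : V b 1 by apply: basic_nbhd1.
have V_le b c : card_le_rel b c -> V c `<=` V b.
  by move=> bc x; apply: basic_nbhd_le.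
have VV b x : V b x -> V b x^-1 by apply: basic_nbhdV.
have [t [tG tH tP tN]] :=
  group_topology_of_base tau_infinite tau_regular V1 V_le VM VV VJ V_sep.
(* Each neighbourhood of [p] contains some [p V b], and with it the point [p * a b] of [A]. *)
apply/nAp/(Aclosed t tG tH tP) => U /tN[b bU].
have [_ Aab] := aHB b.
exists (p * a b); split=> //; apply: bU.
exact/basic_nbhd_gen/Logic.I/wo_refl/card_well_order.
Qed.
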